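(* Let $g\in\mathbb{Z}^+$. There is a constant $K$ depending only on $d,m,n,g$ such that: if $\mathcal{H}_0=\mathcal{B}^0$ and $\mathcal{H}_{r+1}$ is an output of $\mathrm{GARefine}(\mathcal{H}_r,\mathcal{M}_r)$ with $\mathcal{M}_r\subset\mathcal{H}_r$ for $r=0,1,\dots$, then for every $R\ge1$ $$\#\mathcal{H}_R-\#\mathcal{H}_0\le K\sum_{r=0}^{R-1}\#\mathcal{M}_r.$$
   Context: Fix integers $d\ge1$, $n\ge2$, $m\ge2$; $s=n-1$, $p=m-1$. B-splines $\varphi^\ell_{\vec i}(\vec x)=\prod_kQ(n^\ell x_k-i_k)$ for $\ell\ge0$, $\vec i\in\mathbb{Z}^d$, $Q$ the uniform B-spline of order $m$ with knots $0,\dots,m$; $\mathfrak{B}$ the set of all of them; $\mathcal{B}^0=\{\varphi^0_{\vec i}:\vec i\in[-p:0]^d\}$. Children $\mathrm{ch}(\varphi^\ell_{\vec i})=\{\varphi^{\ell+1}_{\vec k}:n\vec i\le\vec k\le n\vec i+sm\}$, extended to sets by union. Cells $I^\ell_{\vec i}=\prod_k[i_kn^{-\ell},(i_k+1)n^{-\ell})$, cell children $\mathrm{ch}(I^\ell_{\vec i})=\{I^{\ell+1}_{\vec k}:n\vec i\le\vec k\le n\vec i+s\}$, $\mathrm{ch}^k$ iterated, $\mathrm{ch}^{-k}(I)=\{J:I\in\mathrm{ch}^k(J)\}$. $\mathbb{I}(\varphi^\ell_{\vec i})=\{I^\ell_{\vec k}:\vec i\le\vec k\le\vec i+p\}$,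 $\mathbb{I}^k(\varphi)=\mathrm{ch}^k(\mathbb{I}(\varphi))$ ($k\in\mathbb{Z}$), $\mathbb{B}^k(I)=\{\varphi\in\mathfrak{B}:I\in\mathbb{I}^{-k}(\varphi)\}$, extended to sets by union; $\mathcal{O}(\varphi,j,\mathcal{H})=\mathbb{B}^j(\mathbb{I}(\varphi))\cap\mathcal{H}$. A lineage is a finite $\mathcal{L}\subset\mathfrak{B}$ with $\mathcal{L}\subset\mathcal{B}^0\cup\mathrm{ch}(\mathcal{L})$; its hierarchical generator is $(\mathcal{B}^0\cup\mathrm{ch}(\mathcal{L}))\setminus\mathcal{L}$ (the lineage is determined by the generator; $\mathcal{B}^0$ has lineage $\emptyset$). $\mathcal{H}$ is absorbing if no $\varphi\in\mathcal{H}$ has $\mathbb{I}(\varphi)\subset\mathbb{I}(\mathcal{L})$. $\mathrm{gap}_{\mathcal{H}}(\varphi)=\sup\{g\in\mathbb{Z}:\mathcal{O}(\varphi,-g,\mathcal{H})\neq\emptyset\}$, $\mathrm{gap}(\mathcal{H})=\max_{\varphi\in\mathcal{H}}\mathrm{gap}_{\mathcal{H}}(\varphi)$. For a generator $\mathcal{H}'$ with lineage $\mathcal{L}'$, $\mathrm{gap}(\mathcal{H}')\le g$ and $\varphi\in\mathcal{H}'$, let $\mathrm{GC}(\mathcal{H}',\varphi)$ be the least (w.r.t. inclusion of lineages) hierarchical generator whose lineage contains $\mathcal{L}'\cup\{\varphi\}$ and whose gap is $\le g$ (it exists). For an absorbing $\mathcal{H}$ with gap $\le g$ and $\mathcal{M}\subset\mathcal{H}$,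 $\mathrm{GARefine}(\mathcal{H},\mathcal{M})$: start with $\mathcal{H}'=\mathcal{H}$; while $\mathcal{M}\cap\mathcal{H}'\neq\emptyset$, choose any $\varphi\in\mathcal{M}\cap\mathcal{H}'$ and replace $\mathcal{H}'$ by $\mathrm{GC}(\mathcal{H}',\varphi)$; then output the least absorbing hierarchical generator whose lineage contains the lineage of the final $\mathcal{H}'$ (it exists; the output is again absorbing with gap $\le g$). Any choice order gives an admissible output. *)

(* Defs.v *)
(* Combinatorial model of hierarchical B-spline refinement
   (GARefine).  A B-spline phi^l_i is identified with its index pair (l, i),
   a cell I^l_i likewise with (l, i); i ranges over Z^d = {ffun 'I_d -> int}.
   Sets of B-splines / cells are Prop-valued predicates. *)
From HB Require Import structures.
From mathcomp Require Import all_boot all_order all_algebra.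
Set Implicit Arguments. Unset Strict Implicit. Unset Printing Implicit Defensive.
Import Order.TTheory GRing.Theory Num.Theory.

Definition vec (d : nat) := {ffun 'I_d -> int}.
Definition bsp (d : nat) := (nat * vec d)%type.
Definition cell (d : nat) := (nat * vec d)%type.
Definition bset (d : nat) := bsp d -> Prop.
Definition cset (d : nat) := cell d -> Prop.

Section Defs.
Variables (d n m : nat).
Local Notation s := (n - 1)%N.
Local Notation p := (m - 1)%N.

Definition seteq (A B : bsp d -> Prop) := forall x, A x <-> B x.
Definition bsubset (A B : bsp d -> Prop) := forall x, A x -> B x.
Definition finite_set (A : bsp d -> Prop) :=
  exists sq : seq (bsp d), forall x, A x <-> x \in sq.
Definition card_is (A : bsp d -> Prop) (k : nat) :=
  exists sq : seq (bsp d), [/\ uniq sq, size sq = k & forall x, A x <-> x \in sq].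

Definition B0 : bset d := fun phi =>
  phi.1 = 0%N /\ forall j, ((- (p%:Z)) <= phi.2 j <= 0)%R.

Definition bch (phi psi : bsp d) : Prop :=
  psi.1 = phi.1.+1 /\
  forall j, ((n%:Z * phi.2 j) <= psi.2 j <= n%:Z * phi.2 j + (s * m)%N%:Z)%R.
Definition chset (L : bset d) : bset d := fun psi => exists phi, L phi /\ bch phi psi.

Definition cch (J I : cell d) : Prop :=
  I.1 = J.1.+1 /\
  forall j, ((n%:Z * J.2 j) <= I.2 j <= n%:Z * J.2 j + s%:Z)%R.

Fixpoint chk (k : nat) (J I : cell d) : Prop :=
  match k with
  | O => J = I
  | S k' => exists J', chk k' J J' /\ cch J' I
  end.
Definition chz (k : int) (J I : cell d) : Prop :=
  match k with
  | Posz k' => chk k' J I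
  | Negz k' => chk k'.+1 I J
  end.

Definition IB (phi : bsp d) (I : cell d) : Prop :=
  I.1 = phi.1 /\ forall j, (phi.2 j <= I.2 j <= phi.2 j + p%:Z)%R.
Definition Ik (k : int) (phi : bsp d) (I : cell d) : Prop :=
  exists J, IB phi J /\ chz k J I.
Definition Bk (k : int) (I : cell d) (phi : bsp d) : Prop := Ik (- k) phi I.
Definition Oset (phi : bsp d) (j : int) (H : bset d) : bset d := fun psi =>
  H psi /\ exists I, IB phi I /\ Bk j I psi.

(* gap(H) <= g, i.e. for every phi in H,
   sup{g' in Z : O(phi,-g',H) <> empty} <= g *)
Definition gap_le (H : bset d) (g : int) : Prop :=
  forall phi, H phi -> forall g' : int, (exists psi, Oset phi (- g') H psi) -> (g' <= g)%R.

Definition lineage (L : bset d) : Prop :=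
  finite_set L /\ forall phi, L phi -> B0 phi \/ chset L phi.
Definition gen (L : bset d) : bset d := fun phi => (B0 phi \/ chset L phi) /\ ~ L phi.
Definition is_gen_of (L H : bset d) : Prop := lineage L /\ seteq H (gen L).

Definition absorbing (L H : bset d) : Prop :=
  forall phi, H phi -> ~ (forall I, IB phi I -> exists psi, L psi /\ IB psi I).

(* L'' is the lineage of GC(gen L', phi) *)
Definition isGC (g : int) (L' : bset d) (phi : bsp d) (L'' : bset d) : Prop :=
  [/\ lineage L'',
      (forall x, L' x \/ x = phi -> L'' x),
      gap_le (gen L'') g &
      forall L3, lineage L3 -> (forall x, L' x \/ x = phi -> L3 x) ->
                 gap_le (gen L3) g -> bsubset L'' L3].

Definition isLeastAbs (Lt Lout : bset d) : Prop :=
  [/\ lineage Lout, bsubset Lt Lout, absorbing Lout (gen Lout) &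
      forall L3, lineage L3 -> bsubset Lt L3 -> absorbing L3 (gen L3) -> bsubset Lout L3].

(* gen Lout is an (admissible) output of GARefine(gen L, M), for some run
   (some choice order) of the while loop *)
Definition GAout (g : int) (L M Lout : bset d) : Prop :=
  [/\ lineage L, absorbing L (gen L), gap_le (gen L) g, bsubset M (gen L) &
      exists (t : nat) (Ls : nat -> bset d),
        [/\ seteq (Ls 0%N) L,
            (forall j, (j < t)%N ->
               exists phi, [/\ M phi, gen (Ls j) phi & isGC g (Ls j) phi (Ls j.+1)]),
            ~ (exists phi, M phi /\ gen (Ls t) phi) &
            isLeastAbs (Ls t) Lout]].
End Defs.

(* Main.v *)
(* A generator is contained in B0 and the children of its lineage, so it suffices
   to bound the size of the lineage.  Graded closure at phi only adds splines of
   level l <= level phi at distance O(n^-l) from phi, and absorption adds no new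
   cells.  Let every marked spline phi give the weight n^(l - level phi) to each
   spline x of level l <= level phi at distance at most D n^-l from it; only
   boundedly many x exist per level, so phi gives away O(1) in total.

   Conversely each x in the final lineage receives at least 1.  Trace x back: x is
   caused by a marked phi_0; a parent of phi_0 was already in the lineage, hence
   is caused by an earlier marked phi_1, and so on, losing at most one level per
   step, until level l is reached.  Step i moves by O(n^-(level phi_i)), that is by
   at most a constant times the weight (rescaled by n^-l) that phi_i gives to x.
   So either the chain stays within distance D n^-l of x and its last member gives
   weight 1, or it leaves that ball, and the weights along it already add up
   to 1. *)
Require Import Defs.
From HB Require Import structures.
From mathcomp Require Import all_boot all_order all_algebra.
From mathcomp Require Import zify lra.
From Stdlib Require Import Classical.
Import Order.TTheory GRing.Theory Num.Theory.

Local Open Scope ring_scope.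

Section Refinement.
Variables (d n m : nat).
Hypotheses (n_gt1 : (1 < n)%N) (m_gt1 : (1 < m)%N).
Implicit Types (a b c phi psi : bsp d) (I J : cell d) (L A : bset d).

(** * Mesh widths, distances and nesting of cells *)

Definition width (l : nat) : rat := (n%:R ^+ l)^-1.
(** Lower corner of a cell or of a spline's support; one definition serves both. *)
Definition pos (a : nat * vec d) (j : 'I_d) : rat := (a.2 j)%:~R * width a.1.
Definition near (a b : nat * vec d) (r : rat) : bool :=
  [forall j, `|pos a j - pos b j| <= r].

Definition admissible L a := B0 m a \/ chset n m L a.

Lemma width_gt0 l : 0 < width l.
Proof. by rewrite invr_gt0 exprn_gt0 // ltr0n ltnW. Qed.

Lemma widthS l : n%:R * width l.+1 = width l.
Proof.
have n0 : (n%:R : rat) != 0 by rewrite pnatr_eq0 -lt0n ltnW.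
by rewrite /width exprS invfM mulrA divff ?mul1r.
Qed.

Lemma widthS_half l : 2%:R * width l.+1 <= width l.
Proof. by rewrite -(widthS l) ler_pM2r ?width_gt0 // ler_nat. Qed.

Lemma width_half l l' : (l < l')%N -> 2%:R * width l' <= width l.
Proof.
elim: l' => // l' IH; rewrite ltnS leq_eqVlt => /orP[/eqP->|/IH ll'].
  exact: widthS_half.
have := widthS_half l'; have := width_gt0 l'; lra.
Qed.

Lemma width_le l l' : (l <= l')%N -> width l' <= width l.
Proof.
rewrite leq_eqVlt => /orP[/eqP->//|/width_half].
by have := width_gt0 l'; lra.
Qed.

Lemma nearP a b r :
  reflect (forall j, `|pos a j - pos b j| <= r) (near a b r).
Proof. exact: forallP. Qed.

Lemma near_sym a b r : near a b r -> near b a r.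
Proof. by move=> /nearP ab; apply/nearP => j; rewrite distrC. Qed.

Lemma near_trans a b c r s : near a b r -> near b c s -> near a c (r + s).
Proof.
move=> /nearP ab /nearP bc; apply/nearP => j.
by rewrite (le_trans (ler_distD (pos b j) _ _)) // lerD.
Qed.

Lemma near_weaken a b r s : near a b r -> r <= s -> near a b s.
Proof. by move=> /nearP ab rs; apply/nearP => j; apply: le_trans rs. Qed.

Lemma near_refl a r : 0 <= r -> near a a r.
Proof. by move=> r0; apply/nearP => j; rewrite subrr normr0. Qed.

(** Serves spline children, with [N] = (n-1)m, and cell children, with [N] = n-1. *)
Lemma pos_refine a b (N : nat) (j : 'I_d) :
  b.1 = a.1.+1 -> n%:Z * a.2 j <= b.2 j <= n%:Z * a.2 j + N%:Z ->
  pos a j <= pos b j <= pos a j + N%:R * width b.1.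
Proof.
move=> lvl; rewrite /pos lvl -(widthS a.1) => /andP[lo hi].
have w0 := width_gt0 a.1.+1.
have E (z : int) : z%:~R * (n%:R * width a.1.+1) = (n%:Z * z)%:~R * width a.1.+1.
  by rewrite intrM mulrA [z%:~R * _]mulrC.
rewrite E ler_pM2r // ler_int lo /= -mulrDl ler_pM2r //.
by rewrite -[N%:R]/(N%:Z%:~R) -intrD ler_int.
Qed.

Lemma bch_near a b : bch n m a b -> near b a (m%:R * width a.1).
Proof.
case=> lvl rng; apply/nearP => j.
have := pos_refine _ _ _ j lvl (rng j); rewrite lvl => /andP[lo hi].
have w0 := width_gt0 a.1.+1.
have : ((n - 1) * m)%N%:R * width a.1.+1 <= m%:R * width a.1.
  rewrite -(widthS a.1) mulrA ler_pM2r // -natrM ler_nat; nia.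
rewrite ger0_norm ?subr_ge0 //; lra.
Qed.

Lemma IB_near a I : IB m a I -> near I a (m%:R * width a.1).
Proof.
case=> lvl rng; apply/nearP => j; rewrite /pos lvl -mulrBl.
have w0 := width_gt0 a.1.
rewrite normrM (gtr0_norm w0) ler_pM2r // -intrB -intr_norm.
by rewrite -[m%:R]/(m%:Z%:~R) ler_int; have := rng j; lia.
Qed.

Lemma cch_pos I J j : cch n J I -> pos J j <= pos I j /\
  pos I j + width I.1 <= pos J j + width J.1.
Proof.
case=> lvl rng; have := pos_refine _ _ _ j lvl (rng j) => /andP[lo hi].
split=> //; move: hi; rewrite lvl -(widthS J.1) natrB ?(ltnW n_gt1) // mulrBl mul1r.
by lra.
Qed.

Lemma chk_pos k I J j : chk n k J I -> pos J j <= pos I j /\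
  pos I j + width I.1 <= pos J j + width J.1.
Proof.
elim: k I => [|k IH] I /=; first by move=> ->.
by case=> J' [/IH [lo hi]] /(cch_pos _ _ j) [lo' hi']; split; lra.
Qed.

Lemma chk_level k I J : chk n k J I -> I.1 = (J.1 + k)%N.
Proof.
elim: k I => [|k IH] I /=; first by move=> ->; rewrite addn0.
by case=> J' [/IH lvl] [-> _]; rewrite lvl addnS.
Qed.

Lemma chk_trans k l I J J' : chk n k J J' -> chk n l J' I -> chk n (k + l) J I.
Proof.
move=> JJ'; elim: l I => [|l IH] I /=; first by move=> <-; rewrite addn0.
by case=> J1 [/IH ? ?]; rewrite addnS; exists J1.
Qed.

Lemma IB_self a : IB m a a.
Proof. by split=> // j; rewrite lexx /=; lia. Qed.

(** Both supports contain the cell [I], so their lower corners differ by at most the longer side,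
    which belongs to the coarser spline [b]. *)
Lemma overlap_near a b k I J : IB m a I -> IB m b J -> chk n k J I ->
  near a b (m%:R * width b.1).
Proof.
move=> [lI rI] [lJ rJ] JI; apply/nearP => j.
have lvl := chk_level _ _ _ JI.
have [lo hi] := chk_pos _ _ _ j JI.
have wa := width_gt0 a.1; have wb := width_gt0 b.1.
have wab : width a.1 <= width b.1 by apply: width_le; rewrite -lI -lJ lvl leq_addr.
rewrite /pos lI lJ in lo hi; rewrite ler_distl /pos.
have p_int (x y : int) : y <= x + (m - 1)%N%:Z -> y%:~R + 1 <= x%:~R + m%:R :> rat.
  by move=> yx; rewrite -[m%:R]/(m%:Z%:~R) -[1]/(1%:~R) -!intrD ler_int; lia.
have /andP[/(ler_wpM2r (ltW wa)) aI aI'] : (((a.2 j)%:~R : rat) <= (I.2 j)%:~R) &&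
    ((I.2 j)%:~R + 1 <= ((a.2 j)%:~R + m%:R : rat)).
  by have /andP[? /p_int->] := rI j; rewrite ler_int andbT.
have /andP[/(ler_wpM2r (ltW wb)) bJ bJ'] : (((b.2 j)%:~R : rat) <= (J.2 j)%:~R) &&
    ((J.2 j)%:~R + 1 <= ((b.2 j)%:~R + m%:R : rat)).
  by have /andP[? /p_int->] := rJ j; rewrite ler_int andbT.
move: aI' bJ' => /(ler_wpM2r (ltW wa)) aI' /(ler_wpM2r (ltW wb)) bJ'.
have m0 : (m%:R : rat) * width a.1 <= m%:R * width b.1 by rewrite ler_wpM2l.
rewrite !mulrDl !mul1r in aI' bJ'.
by apply/andP; split; lra.
Qed.

(** The offset of [I] from n times the index of [a] is at most (n-1)m + (m-1) = nm - 1, so division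
    by n leaves at most m - 1. *)
Lemma bch_parent_cell a b I : bch n m a b -> IB m b I ->
  exists J, IB m a J /\ cch n J I.
Proof.
case=> lvl rng [lI rI]; exists (a.1, [ffun j => (I.2 j %/ n%:Z)%Z]).
have n0 : n%:Z != 0 by lia.
have n_gt0 : 0 < n%:Z by lia.
by split; (split=> /=; [rewrite ?lI ?lvl //|move=> j]); rewrite ffunE;
  have := divz_eq (I.2 j) n%:Z; have := modz_ge0 (I.2 j) n0;
  have := ltz_pmod (I.2 j) n_gt0; have := rng j; have := rI j;
  set q := (_ %/ _)%Z; set t := (_ %% _)%Z; nia.
Qed.

Lemma bch_child_cell a I : IB m a I ->
  exists b J, [/\ bch n m a b, IB m b J & cch n I J].
Proof.
case=> lI rI.
(* The child is chosen so that the corner child of [I] has the same offset in it as [I] has in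
   [a]. *)
exists (a.1.+1, [ffun j => n%:Z * I.2 j - (I.2 j - a.2 j)]).
exists (I.1.+1, [ffun j => n%:Z * I.2 j]).
by split; (split=> /=; [rewrite ?lI //|move=> j]); rewrite !ffunE; have := rI j; nia.
Qed.


(** * Lineages, gaps and chains of splines *)

Lemma sub_finite L A : finite_set L -> bsubset A L -> finite_set A.
Proof.
move=> [s Ls] AL.
suff [t tP] : exists t : seq (bsp d), forall x, x \in t <-> x \in s /\ A x.
  by exists t => x; split=> [Ax|/tP[]//]; apply/tP; split=> //; apply/Ls/AL.
elim: s {Ls} => [|y s [t tP]]; first by exists [::] => x; split=> // -[].
have [Ay|nAy] := classic (A y).
  exists (y :: t) => x; rewrite !inE; split=> [/predU1P[->|/tP[-> //]]|].
    by rewrite eqxx.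
  by rewrite orbT.
  by case=> /predU1P[->|xs] Ax; rewrite ?eqxx //; apply/orP; right; apply/tP.
exists t => x; rewrite inE; split=> [/tP[-> ?]|]; first by rewrite orbT.
by case=> /predU1P[->//|xs] Ax; apply/tP.
Qed.

Lemma finite_level_bound L : finite_set L -> exists N, forall x, L x -> (x.1 < N)%N.
Proof.
case=> s Ls; exists (\max_(x <- s) x.1).+1%N => x /Ls xs.
by rewrite ltnS (big_rem x) //= leq_maxl.
Qed.

Lemma admissible_sub L A a : bsubset L A -> admissible L a -> admissible A a.
Proof. by move=> LA [|[b [/LA]]]; [left|right; exists b]. Qed.

Lemma gap_leP (A : bset d) (g : nat) :
  gap_le n m A g <->
  forall phi psi I J k, A phi -> A psi -> IB m phi I -> IB m psi J ->
    chk n k J I -> (k <= g)%N.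
Proof.
split=> [gapA phi psi I J k Aphi Apsi phiI psiJ JI|gapA phi Aphi [k|k] //].
  apply: (gapA phi Aphi k%:Z); exists psi; split=> //; exists I; split=> //.
  by exists J; split=> //; rewrite opprK.
case=> psi [Apsi [I [phiI [J [psiJ]]]]]; rewrite opprK => JI.
exact: (gapA phi psi I J k).
Qed.

(** While the spline is in [L], pass to a child over a child cell; levels in the finite [L] are
    bounded, so this stops. *)
Lemma descend L a I : finite_set L -> admissible L a -> IB m a I ->
  exists b J k, [/\ gen n m L b, IB m b J & chk n k I J].
Proof.
move=> /finite_level_bound[N LN].
have [u] := ubnP (N - a.1)%N; elim: u a I => // u IH a I ua La aI.
have [La'|nLa] := classic (L a); last by exists a, I, 0%N.
have [b [J [ab bJ IJ]]] := bch_child_cell a I aI.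
have [|||c [J' [k [gc cJ' JJ']]]] := IH b J.
- by have := LN a La'; case: ab => ->; lia.
- by right; exists a.
- by [].
exists c, J', (1 + k)%N; split=> //; apply: chk_trans JJ'.
by exists I.
Qed.

(** Pass to parents outside [L] until the parent lies in [L] or the spline lies in [B0]; ancestors
    of [J] follow along. *)
Lemma climb L A b J :
  (forall x, A x -> admissible A x) -> admissible A b -> ~ L b -> IB m b J ->
  exists c J' k, [/\ gen n m L c, IB m c J' & chk n k J' J].
Proof.
move=> linA; have [u] := ubnP b.1; elim: u b J => // u IH b J ub.
case=> [B0b|[a [Aa ab]]] nLb bJ.
  by exists b, J, 0%N; split=> //; split=> //; left.
have [La|nLa] := classic (L a).
  by exists b, J, 0%N; split=> //; split=> //; right; exists a.
have [J1 [aJ1 J1J]] := bch_parent_cell a b J ab bJ.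
have [|c [J' [k [gc cJ' J'J1]]]] := IH a J1 _ (linA a Aa) nLa aJ1.
  by case: ab ub => ->.
by exists c, J', k.+1; split=> //; exists J1.
Qed.

(** * Locality of graded closure *)

Section GradedClosure.
Variables (g : nat) (L L' : bset d) (phi : bsp d).
Hypotheses (g_gt0 : (0 < g)%N) (lineageL : lineage n m L).
Hypotheses (gapL : gap_le n m (gen n m L) g) (gcL : isGC n m g L phi L').

Let nearby : bset d := fun y =>
  [/\ L' y, (y.1 <= phi.1)%N & near y phi ((3 * m)%:R * width y.1)].
Let A : bset d := fun y => L y \/ nearby y.

(** The radius 3m reproduces itself: a coarser [z] has at least twice the width of [y], so 4m
    [width y.1] + m [width z.1] is at most 3m [width z.1]. *)
Let nearbyW y z : L' z -> (z.1 < y.1)%N -> nearby y ->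
  near z y (m%:R * width y.1 + m%:R * width z.1) -> nearby z.
Proof.
move=> L'z zy [_ yphi yn] zn; split=> //; first by lia.
apply: near_weaken (near_trans _ _ _ _ _ zn yn) _.
rewrite natrM; have := width_half _ _ zy.
move/(ler_wpM2l (ler0n rat m)); have := width_gt0 y.1; have := width_gt0 z.1.
nra.
Qed.

(* The elements of [L'] that are in [L] or close to [phi] already form a lineage
   of gap at most [g], so minimality of [L'] leaves no others. *)
Lemma isGC_nearby y : L' y -> L y \/
  (y.1 <= phi.1)%N /\ near y phi ((3 * m)%:R * width y.1).
Proof.
have [[finL' linL'] subL' gapL' minL'] := gcL.
have [finL linL] := lineageL.
have AL' : bsubset A L' by move=> x [Lx|[]//]; apply: subL'; left.
suff AA : bsubset L' A by move=> /AA[|[]]; [left|right].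
apply: minL' => [||].
- split=> [|y']; first exact: sub_finite finL' AL'.
  case=> [/linL|ny]; first by apply: admissible_sub => x; left.
  have [L'y _ _] := ny; have [B0y|[z [L'z zy]]] := linL' _ L'y; first by left.
  right; exists z; split=> //; right; apply: nearbyW (ny) _ => //.
    by case: zy => ->.
  apply: near_weaken (near_sym _ _ _ (bch_near _ _ zy)) _.
  by rewrite lerDr mulr_ge0 // ltW // width_gt0.
- move=> x [Lx|->]; [by left|right; split=> //; first by apply: subL'; right].
  by apply: near_refl; rewrite mulr_ge0 // ltW // width_gt0.
apply/gap_leP => al be I J k [adm_al _] [adm_be nAbe] alI beJ JI.
rewrite leqNgt; apply/negP => gk.
have linA' x : L' x -> admissible L' x by exact: linL'.
(* If [al] was already admissible for [L], descending from it and climbing from [be] gives a pair in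
   [gen n m L] with a gap at least [k]. *)
have gap_contra : admissible L al -> False.
  move=> adm_al'.
  have [al' [I' [k1 [gal' al'I' II']]]] := descend L al I finL adm_al' alI.
  have nLbe : ~ L be by move=> Lbe; apply: nAbe; left.
  have [be' [J' [k2 [gbe' be'J' J'J]]]] :=
    climb L L' be J linA' (admissible_sub _ _ _ AL' adm_be) nLbe beJ.
  have := (gap_leP _ _).1 gapL _ _ _ _ _ gal' gbe' al'I' be'J'
    (chk_trans _ _ _ _ _ (chk_trans _ _ _ _ _ J'J JI) II'); lia.
case: adm_al => [B0al|[a [[La|na] aal]]].
- by apply: gap_contra; left.
- by apply: gap_contra; right; exists a.
have L'al : admissible L' al by right; exists a; split=> //; case: na.
have [L'be|nL'be] := classic (L' be); last first.
  have gbe : gen n m L' be by split=> //; exact: admissible_sub adm_be.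
  have [al' [I' [k1 [gal' al'I' II']]]] := descend L' al I finL' L'al alI.
  have := (gap_leP _ _).1 gapL' _ _ _ _ _ gal' gbe al'I' beJ
    (chk_trans _ _ _ _ _ JI II'); lia.
(* Since [k] > [g] >= 1, [be] is strictly coarser than the parent [a] of [al], so it inherits
   nearness from [a]. *)
apply: nAbe; right; apply: nearbyW (na) _ => //.
  have := chk_level _ _ _ JI; case: alI beJ aal => -> _ [-> _] [-> _]; lia.
apply: near_weaken (near_trans _ _ _ _ _ (near_sym _ _ _ (overlap_near _ _ _ _ _ alI beJ JI)) (bch_near _ _ aal)) _.
by rewrite addrC.
Qed.

End GradedClosure.

(** * Absorption adds no cells *)

Section Absorption.
Variables (Lt Lout : bset d).

(* The witness for minimality: the part of [Lout] that is reached from [B0] by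
   splines without cells outside those of [Lt]. *)
Inductive covered : bset d :=
| covered_root a : Lout a ->
    (forall I, IB m a I -> exists b, Lt b /\ IB m b I) -> B0 m a -> covered a
| covered_child a b : Lout b ->
    (forall I, IB m b I -> exists c, Lt c /\ IB m c I) ->
    covered a -> bch n m a b -> covered b.

Lemma covered_intro a : Lout a ->
  (forall I, IB m a I -> exists b, Lt b /\ IB m b I) ->
  admissible covered a -> covered a.
Proof.
by move=> aout cov [B0a|[b [cb ba]]]; [exact: covered_root|exact: covered_child ba].
Qed.

(** [covered] is a lineage containing [Lt]. It is absorbing: a generator element with all its cells
    taken would be covered if it lay in [Lout], and would contradict absorption of [Lout] otherwise.
    Minimality then gives [Lout] inside [covered]. *)
Lemma isLeastAbs_cells a I : lineage n m Lt -> isLeastAbs n m Lt Lout ->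
  Lout a -> IB m a I -> exists b, Lt b /\ IB m b I.
Proof.
move=> [_ linLt] [[finout linout] subout absout minout].
have cov_out : bsubset covered Lout by move=> x [].
have cov_cells x J : covered x -> IB m x J -> exists b, Lt b /\ IB m b J.
  by case=> {}x => [|c] _ h => [_|_ _]; exact: h.
suff out_cov : bsubset Lout covered by move=> /out_cov; exact: cov_cells.
apply: minout => [|x|x [admx ncovx] covx].
- split=> [|x []]; first exact: sub_finite finout cov_out.
    by left.
  by move=> c b _ _ cc cb; right; exists c.
- have [u] := ubnP x.1; elim: u x => // u IH x ux Ltx.
  apply: covered_intro => [||]; first exact: subout.
    by move=> J xJ; exists x.
  have [B0x|[y [Lty yx]]] := linLt x Ltx; first by left.
  by right; exists y; split=> //; apply: IH => //; case: yx ux => ->.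
have [xout|nxout] := classic (Lout x).
  apply: ncovx; apply: covered_intro => // J /covx[b [cb bJ]].
  exact: cov_cells cb bJ.
apply: (absout x) => [|J /covx[b [/cov_out]]]; last by exists b.
by split=> //; exact: admissible_sub admx.
Qed.

End Absorption.

(** * Counting splines of one level in a box *)

Lemma sum_nat_count (T : Type) (s : seq T) (P : pred T) :
  (\sum_(x <- s) P x = count P s)%N.
Proof. by rewrite -sum1_count [RHS]big_mkcond; apply: eq_bigr => x _; case: (P x). Qed.

Lemma box_card (s : seq (vec d)) (c : vec d) (N : nat) : uniq s ->
  (forall x, x \in s -> forall j, c j <= x j <= c j + N%:Z) ->
  (size s <= N.+1 ^ d)%N.
Proof.
move=> us box; pose f (x : vec d) := [ffun j => inord `|x j - c j|%N : 'I_N.+1].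
have f_inj : {in s &, injective f}.
  move=> x y xs ys /ffunP fxy; apply/ffunP => j.
  have := congr1 val (fxy j); rewrite !ffunE /=.
  have := box x xs j; have := box y ys j.
  move: (x j) (y j) (c j) => u v w vb ub.
  by rewrite !inordK; lia.
rewrite -(size_map f) -(card_uniqP _) ?map_inj_in_uniq //.
by rewrite (leq_trans (max_card _)) // card_ffun !card_ord.
Qed.

Lemma level_box_card (s : seq (bsp d)) l (c : vec d) (N : nat) : uniq s ->
  (forall x, x \in s -> x.1 = l /\ forall j, c j <= x.2 j <= c j + N%:Z) ->
  (size s <= N.+1 ^ d)%N.
Proof.
move=> us box; rewrite -(size_map snd); apply: (box_card _ c).
  rewrite map_inj_in_uniq // => -[x1 x2] [y1 y2] /box[/= -> _] /box[/= -> _].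
  by move=> ->.
by move=> _ /mapP[x /box[_ xbox] ->].
Qed.

Lemma near_card (s : seq (bsp d)) l phi (N : nat) : uniq s ->
  (forall x, x \in s -> x.1 = l /\ near x phi (N%:R * width x.1)) ->
  (size s <= (4 * N).+1 ^ d)%N.
Proof.
case: s => [|x0 s] // us nears.
(* [phi] may have another level, so the box is centred at a member [x0]; any two members are within
   2N mesh widths. *)
apply: (level_box_card _ l [ffun j => x0.2 j - (2 * N)%N%:Z] (4 * N)) => // x xs.
have [xl xn] := nears x xs; split=> // j; rewrite ffunE.
have [x0l x0n] := nears x0 (mem_head _ _).
have /nearP/(_ j) := near_trans _ _ _ _ _ xn (near_sym _ _ _ x0n).
rewrite /pos xl x0l -mulrBl -mulrDl normrM (gtr0_norm (width_gt0 l)).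
rewrite ler_pM2r ?width_gt0 // -intrB -intr_norm -natrD -[_%:R]/((_)%:Z%:~R).
rewrite ler_int.
have centre (u v : int) : `|u - v| <= (N + N)%N%:Z ->
  v - (2 * N)%N%:Z <= u <= v - (2 * N)%N%:Z + (4 * N)%N%:Z by lia.
exact: centre.
Qed.

(** * Weights and their total *)

Lemma sum_width_le N : \sum_(l < N) width l <= 2%:R.
Proof.
(* The extra term dominates the tail of the geometric series and makes the induction close. *)
suff H : 2%:R * width N + \sum_(l < N) width l <= 2%:R.
  by have := width_gt0 N; lra.
elim: N => [|N IH]; first by rewrite big_ord0 /width expr0 invr1; lra.
by rewrite big_ord_recr /=; have := widthS_half N; lra.
Qed.

(** [C] = m + 3m: from a cell to its spline, then to the marked spline. [C'] pays m + [C] = 5m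
    parent widths, each n widths of the child. [D] = [C] + [C'] covers a chain's last step. *)
Let C : nat := (4 * m)%N.
Let C' : nat := (5 * m * n)%N.
Let D : nat := (C + C')%N.

Definition weight (x phi : bsp d) : rat :=
  if (x.1 <= phi.1)%N && near x phi (D%:R * width x.1)
  then width (phi.1 - x.1) else 0.

Lemma weight_ge0 x phi : 0 <= weight x phi.
Proof. by rewrite /weight; case: ifP => // _; rewrite ltW // width_gt0. Qed.

Lemma weight_total (s : seq (bsp d)) phi : uniq s ->
  \sum_(x <- s) weight x phi <= (2 * (4 * D).+1 ^ d)%N%:R.
Proof.
move=> us.
(* Slices by the level difference [l]: each holds boundedly many splines, all of weight
   [width l]. *)
pose P (l : nat) (x : bsp d) :=
  (x.1 == phi.1 - l)%N && near x phi (D%:R * width x.1).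
have le_slices x : weight x phi <= \sum_(l < phi.1.+1) width l * (P l x)%:R.
  have ge0 l (e : bool) : 0 <= width l * e%:R.
    by rewrite mulr_ge0 // ltW // width_gt0.
  rewrite /weight; case: ifP => [/andP[xphi nx]|_]; last first.
    by apply: sumr_ge0 => l _; exact: ge0.
  have lt : (phi.1 - x.1 < phi.1.+1)%N by rewrite ltnS leq_subr.
  rewrite (bigD1 (Ordinal lt)) //= /P nx subKn // eqxx mulr1 lerDl.
  by apply: sumr_ge0 => l _; exact: ge0.
apply: le_trans (ler_sum _ (fun x _ => le_slices x)) _.
rewrite exchange_big /= natrM.
apply: le_trans (_ : \sum_(l < phi.1.+1) width l * ((4 * D).+1 ^ d)%N%:R <= _).
  apply: ler_sum => l _; rewrite -mulr_sumr ler_wpM2l ?(ltW (width_gt0 _)) //.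
  rewrite -natr_sum ler_nat sum_nat_count -size_filter.
  apply: (near_card _ (phi.1 - l)%N phi); first exact: filter_uniq.
  by move=> x; rewrite mem_filter => /andP[/andP[/eqP-> ?] _].
by rewrite -mulr_suml ler_wpM2r // sum_width_le.
Qed.

(** * Rounds of refinement and the payment invariant *)

Lemma lineage_eqset L A : seteq L A -> lineage n m L -> lineage n m A.
Proof.
move=> LA [finL linL]; split=> [|x /LA /linL].
  by apply: sub_finite finL _ => x /LA.
by apply: admissible_sub => y /LA.
Qed.

Lemma gap_le_gen_eqset L A (g : nat) : seteq L A ->
  gap_le n m (gen n m L) g -> gap_le n m (gen n m A) g.
Proof.
move=> LA /gap_leP gapL; apply/gap_leP => phi psi I J k [aphi nphi] [apsi npsi].
have sub : bsubset A L by move=> y /LA.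
by apply: gapL; split=> [|/LA//]; exact: admissible_sub sub _.
Qed.

(** The radius does not grow with [t]: each new spline stays attributed to the closure that first
    added it. *)
Lemma gradedClosures_nearby (g t : nat) L (M : bset d) (Ls : nat -> bset d) :
  (0 < g)%N -> lineage n m L -> gap_le n m (gen n m L) g -> seteq (Ls 0%N) L ->
  (forall j, (j < t)%N -> exists phi,
     [/\ M phi, gen n m (Ls j) phi & isGC n m g (Ls j) phi (Ls j.+1)]) ->
  lineage n m (Ls t) /\
  forall z, Ls t z -> L z \/ exists phi,
    [/\ M phi, (z.1 <= phi.1)%N & near z phi ((3 * m)%:R * width z.1)].
Proof.
move=> g0 linL gapL Ls0 steps.
suff H j : (j <= t)%N -> [/\ lineage n m (Ls j), gap_le n m (gen n m (Ls j)) g &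
    forall z, Ls j z -> L z \/ exists phi,
      [/\ M phi, (z.1 <= phi.1)%N & near z phi ((3 * m)%:R * width z.1)]].
  by have [] := H t (leqnn t).
elim: j => [_|j IH jt].
  have LLs : seteq L (Ls 0%N) by move=> x; split=> /Ls0.
  split; [exact: lineage_eqset linL|exact: gap_le_gen_eqset gapL|].
  by move=> z /Ls0; left.
have [linj gapj nearj] := IH (ltnW jt).
have [phi [Mphi _ gc]] := steps j jt.
have [linj' _ gapj' _] := gc.
split=> // z /(isGC_nearby _ _ _ _ g0 linj gapj gc)[/nearj//|[zphi zn]].
by right; exists phi.
Qed.

(* Invariant of the induction on rounds: the distance from [x] to a cell of the
   lineage plus the weight already received by [x] never drops below the budget
   [D]; each backward step to an earlier marked spline pays for its length. *)
Definition paid (s : seq (bsp d)) L := forall x y I r, L y -> IB m y I ->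
  (x.1 <= I.1)%N -> 0 <= r -> near x I r ->
  D%:R * width x.1 <=
    r + C%:R * width I.1 + C'%:R * width x.1 * \sum_(phi <- s) weight x phi.

Lemma widthM l l' : (l <= l')%N -> width l * width (l' - l) = width l'.
Proof. by move=> ll'; rewrite /width -invfM -exprD subnKC. Qed.

Lemma paid_refine (g : nat) (s t : seq (bsp d)) L (M Lout : bset d) :
  (0 < g)%N -> (forall x, M x <-> x \in t) -> GAout n m g L M Lout ->
  paid s L -> paid (s ++ t) Lout.
Proof.
move=> g0 Mt [linL _ gapL Mgen [k [Ls [Ls0 steps _ abs]]]] paidL x y I r.
move=> Louty yI xI r0 xIr.
have [linLt nearLt] := gradedClosures_nearby _ _ _ _ _ g0 linL gapL Ls0 steps.
have [z [Ltz zI]] := isLeastAbs_cells _ _ y I linLt abs Louty yI.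
have wx := width_gt0 x.1; have wI := width_gt0 I.1.
have sum_ge0 (u : seq (bsp d)) : 0 <= \sum_(phi <- u) weight x phi.
  by apply: sumr_ge0 => phi _; exact: weight_ge0.
have C'w_ge0 : 0 <= C'%:R * width x.1 by rewrite mulr_ge0 // ltW.
rewrite big_cat /= mulrDr.
have tokens_t := mulr_ge0 C'w_ge0 (sum_ge0 t).
have tokens_s := mulr_ge0 C'w_ge0 (sum_ge0 s).
have [Lz|[phi [Mphi zphi zn]]] := nearLt z Ltz.
  by have := paidL x z I r Lz zI xI r0 xIr; lra.
have Iz : I.1 = z.1 by case: zI.
have xphi : near x phi (r + C%:R * width I.1).
  apply: near_weaken (near_trans _ _ _ _ _ xIr (near_trans _ _ _ _ _ (IB_near _ _ zI) zn)) _.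
  by rewrite Iz -mulrDl -natrD lerD2l ler_pM2r ?width_gt0 // ler_nat /C; lia.
(* If the bound on the distance to [phi] exceeds the budget, the inequality holds without any
   weights. *)
have [far|close] := ltP (D%:R * width x.1) (r + C%:R * width I.1).
  by have := lerD tokens_s tokens_t; lra.
have xphi_lvl : (x.1 <= phi.1)%N by rewrite (leq_trans xI) // Iz.
have token : C'%:R * width phi.1 <= C'%:R * width x.1 * \sum_(psi <- t) weight x psi.
  rewrite -(widthM _ _ xphi_lvl) mulrA ler_wpM2l //.
  rewrite (big_rem phi) /=; last exact/Mt.
  rewrite {1}/weight xphi_lvl (near_weaken _ _ _ _ xphi close) lerDl.
  by apply: sumr_ge0 => psi _; exact: weight_ge0.
(* At equal levels the chain ends: [phi] gives weight 1, and [C] + [C'] = [D]. *)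
move: xphi_lvl; rewrite leq_eqVlt => /orP[/eqP xphi_lvl|xphi_lvl].
  have Ix : I.1 = x.1 by apply/eqP; rewrite eqn_leq xI xphi_lvl Iz zphi.
  by move: token; rewrite -xphi_lvl Ix [D%:R]natrD mulrDl; lra.
have [[[phi0 _]|[a [La aphi]]] _] := Mgen phi Mphi; first by rewrite phi0 in xphi_lvl.
have phi_lvl : phi.1 = a.1.+1 by case: aphi.
have a0 := width_gt0 a.1.
have xa := near_trans _ _ _ _ _ xphi (bch_near _ _ aphi).
(* The invariant is applied to the parent [a], read as its own corner cell; the weight of [phi] pays
   for the extra (m + [C]) [width a.1]. *)
have := paidL x a a _ La (IB_self a) _ _ xa.
rewrite -ltnS -phi_lvl xphi_lvl => /(_ isT).
have -> : 0 <= r + C%:R * width I.1 + m%:R * width a.1.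
  by rewrite !addr_ge0 // mulr_ge0 // ltW.
move=> /(_ isT); move: token.
have -> : C'%:R * width phi.1 = (m + C)%N%:R * width a.1.
  rewrite /C' natrM -mulrA phi_lvl widthS; congr (_%:R * _); rewrite /C; lia.
rewrite natrD mulrDl; lra.
Qed.

(** Ancestors of a member of [L] would lead to a member in [B0], but all of [B0] lies in the
    generator, hence outside [L]. *)
Lemma generator_B0_lineage L : lineage n m L -> seteq (gen n m L) (B0 m) ->
  forall x, ~ L x.
Proof.
move=> [_ linL] genL x; have [u] := ubnP x.1; elim: u x => // u IH x ux Lx.
have [B0x|[y [Ly [lvl _]]]] := linL x Lx.
  by have [_] := (genL x).2 B0x.
by apply: IH Ly; move: ux; rewrite lvl.
Qed.

Lemma paid_iter (g : nat) (L M : nat -> bset d) (cM : nat -> nat) R :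
  (0 < g)%N -> (forall x, ~ L 0%N x) ->
  (forall r, (r < R)%N -> GAout n m g (L r) (M r) (L r.+1)) ->
  (forall r, (r < R)%N -> card_is (M r) (cM r)) ->
  exists s, size s = (\sum_(r < R) cM r)%N /\ paid s (L R).
Proof.
move=> g0 L0; elim: R => [|R IH] ga cardM.
  by exists [::]; rewrite big_ord0; split=> // x y I r /L0.
have [||s [ss paids]] := IH.
- by move=> r rR; apply: ga; exact: ltnW.
- by move=> r rR; apply: cardM; exact: ltnW.
have [t [_ st Mt]] := cardM R (ltnSn R).
exists (s ++ t); rewrite size_cat ss st big_ord_recr; split=> //.
exact: paid_refine g0 Mt (ga R (ltnSn R)) paids.
Qed.

(** The invariant at [x] itself with distance 0: after subtracting [C], the weights must cover [C']
    alone. *)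
Lemma paid_weight (s : seq (bsp d)) L x : paid s L -> L x ->
  1 <= \sum_(phi <- s) weight x phi.
Proof.
move=> paids Lx; have := paids x x x 0 Lx (IB_self x) (leqnn _) (lexx 0).
rewrite near_refl // => /(_ isT); rewrite natrD.
have wx := width_gt0 x.1; rewrite -mulrA [_ * \sum_(_ <- _) _]mulrC.
have C'w : 0 < C'%:R * width x.1 by rewrite mulr_gt0 // ltr0n /C'; lia.
move=> h; rewrite -(ler_pM2r C'w); lra.
Qed.

(** * From the lineage to the generator *)

Definition childb (a b : bsp d) : bool :=
  (b.1 == a.1.+1) &&
  [forall j, n%:Z * a.2 j <= b.2 j <= n%:Z * a.2 j + ((n - 1) * m)%N%:Z].

Lemma childP a b : reflect (bch n m a b) (childb a b).
Proof.
apply: (iffP andP) => [[/eqP ? /forallP ?]|[? ?]]; split=> //; first exact/eqP.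
exact/forallP.
Qed.

(** Double counting of parent-child pairs: a spline has at most ((n-1)m + 1)^d children. *)
Lemma generator_card (sH sH0 sL : seq (bsp d)) :
  uniq sH ->
  (forall x, x \in sH -> x \in sH0 \/ exists y, y \in sL /\ bch n m y x) ->
  (size sH <= size sH0 + ((n - 1) * m).+1 ^ d * size sL)%N.
Proof.
move=> uH covH; rewrite -(count_predC (mem sH0) sH) leq_add //.
  rewrite -size_filter uniq_leq_size ?filter_uniq // => x.
  by rewrite mem_filter => /andP[].
rewrite -sum_nat_count.
apply: leq_trans (_ : \sum_(x <- sH) \sum_(y <- sL) childb y x <= _)%N.
  rewrite !big_seq; apply: leq_sum => x /covH[xH0|[y [yL /childP yx]]].
    by rewrite /= xH0.
  by rewrite (big_rem y) //= yx add1n; case: (_ \in _).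
rewrite exchange_big /=.
apply: leq_trans (_ : \sum_(y <- sL) ((n - 1) * m).+1 ^ d <= _)%N; last first.
  by rewrite big_const_seq iter_addn_0 count_predT mulnC.
apply: leq_sum => y _; rewrite sum_nat_count -size_filter.
apply: (level_box_card _ y.1.+1 [ffun j => n%:Z * y.2 j]).
  exact: filter_uniq.
move=> x; rewrite mem_filter => /andP[/childP[lvl rng] _].
by split=> // j; rewrite ffunE; exact: rng.
Qed.

Lemma refinement_bound (g : nat) (L M : nat -> bset d) (cM : nat -> nat) R
    (sL : seq (bsp d)) :
  (0 < g)%N -> (forall x, ~ L 0%N x) ->
  (forall r, (r < R)%N -> GAout n m g (L r) (M r) (L r.+1)) ->
  (forall r, (r < R)%N -> card_is (M r) (cM r)) ->
  uniq sL -> (forall x, x \in sL -> L R x) ->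
  (size sL <= 2 * (4 * (4 * m + 5 * m * n)).+1 ^ d * \sum_(r < R) cM r)%N.
Proof.
move=> g0 L0 ga cardM uL sLL.
have [s [<- paids]] := paid_iter g L M cM R g0 L0 ga cardM.
rewrite -(ler_nat rat).
apply: le_trans (_ : \sum_(x <- sL) \sum_(phi <- s) weight x phi <= _).
  rewrite -sum1_size natr_sum !big_seq; apply: ler_sum => x /sLL Lx.
  exact: paid_weight paids Lx.
rewrite exchange_big mulnC natrM -sum1_size natr_sum mulr_suml.
by apply: ler_sum => phi _; rewrite mul1r; exact: weight_total.
Qed.

End Refinement.

Local Close Scope ring_scope.

Theorem theorem9p3 :
  forall (d n m g : nat), (0 < d)%N -> (1 < n)%N -> (1 < m)%N -> (0 < g)%N ->
  exists K : nat,
  forall (H L M : nat -> bset d) (R : nat), (1 <= R)%N ->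
    (forall r, (r <= R)%N -> is_gen_of n m (L r) (H r)) ->
    seteq (H 0%N) (B0 m) ->
    (forall r, (r < R)%N -> bsubset (M r) (H r)) ->
    (forall r, (r < R)%N -> GAout n m (g%:Z) (L r) (M r) (L r.+1)) ->
    forall cH cM : nat -> nat,
    (forall r, (r <= R)%N -> card_is (H r) (cH r)) ->
    (forall r, (r < R)%N -> card_is (M r) (cM r)) ->
    ((cH R)%:Z - (cH 0%N)%:Z <= (K * \sum_(r < R) cM r)%N%:Z)%R.
Proof.
move=> d n m g _ n_gt1 m_gt1 g0.
(* Bound on the children per spline times bound on the total weight given by one marked spline. *)
exists (((n - 1) * m).+1 ^ d * (2 * (4 * (4 * m + 5 * m * n)).+1 ^ d)).
move=> H L M R _ genH H0 _ ga cH cM cardH cardM.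
have [linL0 HL0] := genH 0%N (leq0n R).
have [[[s Ls] _] HLR] := genH R (leqnn R).
have L0 : forall x, ~ L 0%N x.
  by apply: generator_B0_lineage linL0 _ => x; split=> [/HL0/H0|/H0/HL0].
have [sH [uH <- HsH]] := cardH R (leqnn R).
have [sH0 [_ <- HsH0]] := cardH 0%N (leq0n R).
have in_L x : x \in undup s -> L R x by rewrite mem_undup => /Ls.
have leL := refinement_bound d n m n_gt1 m_gt1 g L M cM R (undup s) g0 L0 ga cardM
  (undup_uniq s) in_L.
have leH : size sH <= size sH0 + ((n - 1) * m).+1 ^ d * size (undup s).
  apply: (generator_card d n m) => // x /HsH /HLR [[B0x|[y [Ly yx]]] _].
    by left; apply/HsH0/H0.
  by right; exists y; rewrite mem_undup; split=> //; apply/Ls.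
rewrite lerBlDl -PoszD lez_nat (leq_trans leH) // leq_add2l.
by rewrite -[X in _ <= X]mulnA leq_mul2l leL orbT.
Qed.
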